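(* Let $n\geq 2$ be an even integer. There is an effectively computable constant $c_n$, depending only on $n$, such that for every finite field $\mathbb{F}_q$ with $q$ odd and any two distinct smooth quadrics $C$ and $D$ in $\mathbb{P}^n$ over $\mathbb{F}_q$, the number $N$ of points $\underline{x}\in\mathbb{P}^n(\mathbb{F}_q)$ external to $C$ but internal to $D$ satisfies \[\left|N-\frac{q^n}{4}\right|\leq \frac{3}{2}q^{n-1/2}+c_n q^{n-1}.\]
   Context: Let $n$ be even, $q$ odd, and let $C=\{f=0\}\subset\mathbb{P}^n$ be a smooth quadric over $\mathbb{F}_q$ ($f$ a nondegenerate quadratic form in $n+1$ variables). Let $P\in\mathbb{P}^n(\mathbb{F}_q)$ be a point not on $C$, and let $P^\perp$ be its polar hyperplane with respect to $C$ (the hyperplane orthogonal to $P$ under the symmetric bilinear form associated with $f$). Then $C\cap P^\perp$ is a smooth quadric in $P^\perp\cong\mathbb{P}^{n-1}$, with $n-1$ odd, hence is either hyperbolic (the restricted form is an orthogonal sum of hyperbolic planes) or elliptic (otherwise). The point $P$ is called external to $C$ if $C\cap P^\perp$ is hyperbolic, and internal to $C$ if $C\cap P^\perp$ is elliptic. For $n=2$ (conics), $P$ is external if there are two $\mathbb{F}_q$-tangent lines to $C$ through $P$ and internal if there are none. *)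

(* Defs.v *)
From HB Require Import structures.
From mathcomp Require Import all_boot all_order all_algebra.
From mathcomp Require Import mpoly.

Set Implicit Arguments.
Unset Strict Implicit.
Unset Printing Implicit Defensive.

Import Order.TTheory GRing.Theory Num.Theory.
Local Open Scope ring_scope.

(* Kleene's mu-recursive functions; [murec k] are the programs of arity k. *)
Inductive murec : nat -> Type :=
| MZero : murec 0
| MSucc : murec 1
| MProj k of 'I_k : murec k
| MComp k l of murec k & ('I_k -> murec l) : murec l
| MPrec k of murec k & murec k.+2 : murec k.+1
| MMu k of murec k.+1 : murec k.

(* [computes p v y]: the program p halts on the input v with output y.  The
   recursion variable of MPrec and the search variable of MMu come first; the
   step of MPrec is applied to (i, value at i, parameters). *)
Fixpoint computes k (p : murec k) : k.-tuple nat -> nat -> Prop :=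
  match p in murec k return k.-tuple nat -> nat -> Prop with
  | MZero => fun _ y => y = 0%N
  | MSucc => fun v y => y = (thead v).+1
  | MProj _ i => fun v y => y = tnth v i
  | MComp k _ f gs => fun v y => exists w : k.-tuple nat,
      (forall i, computes (gs i) v (tnth w i)) /\ computes f w y
  | MPrec _ f g => fun v y => exists s : nat -> nat,
      [/\ computes f [tuple of behead v] (s 0%N),
          forall i, (i < thead v)%N ->
            computes g [tuple of i :: s i :: behead v] (s i.+1)
        & y = s (thead v)]
  | MMu _ f => fun v y =>
      computes f [tuple of y :: v] 0%N /\
      forall i, (i < y)%N -> exists z, computes f [tuple of i :: v] z.+1
  end.

Definition effectively_computable (c : nat -> nat) : Prop :=
  exists p : murec 1, forall k, computes p [tuple k] (c k).

Section Quadrics.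

Variables (F : finFieldType) (n : nat).

Local Notation V := 'rV[F]_n.+1.

Implicit Types (f g : {mpoly F[n.+1]}) (x y : V) (P W : {set V}).

Definition evalf f x : F := f.@[fun i => x 0 i].

(* The symmetric bilinear form associated with a quadratic form f, normalised
   so that polar f x x = 2 f(x); F is meant to have odd characteristic. *)
Definition polar f x y : F := evalf f (x + y) - evalf f x - evalf f y.

Definition nondegenerate f : Prop :=
  forall x, (forall y, polar f x y = 0) -> x = 0.

Definition smooth_quadric f : Prop := f \is 2.-homog /\ nondegenerate f.

(* {f = 0} and {g = 0} are the same hypersurface (subscheme) of P^n when f and
   g generate the same ideal, i.e. agree up to a nonzero constant. Comparing
   sets of F-points instead would not be the right notion of equality. *)
Definition same_quadric f g : Prop := exists2 a : F, a != 0 & g = a *: f.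

(* P^n(F): its points are the lines of F^(n+1), each as its set of vectors. *)
Definition proj_space : {set {set V}} :=
  [set [set a *: x | a : F] | x : V & x != 0].

Definition on_quadric f P : bool := [forall x in P, evalf f x == 0].

Definition polar_hyperplane f P : {set V} :=
  [set y | [forall x in P, polar f x y == 0]].

(* f restricted to W is an orthogonal sum of m hyperbolic planes <e i, h i>.
   The vectors e i, h i are then automatically linearly independent, their Gram
   matrix being invertible. *)
Definition hyperbolic (m : nat) f W : bool :=
  [exists e : {ffun 'I_m -> V}, exists h : {ffun 'I_m -> V},
    [&& [forall i, [&& evalf f (e i) == 0, evalf f (h i) == 0
                     & polar f (e i) (h i) == 1]],
        [forall i, forall j, (i != j) ==>
           [&& polar f (e i) (e j) == 0, polar f (e i) (h j) == 0
             & polar f (h i) (h j) == 0]]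
      & W == [set \sum_(i < m) (a i *: e i + b i *: h i)
               | a : {ffun 'I_m -> F}, b : {ffun 'I_m -> F}]]].

(* For n even, the polar hyperplane of a point off the quadric has dimension
   n = 2 * n./2 as a vector space. *)
Definition external f P : bool :=
  ~~ on_quadric f P && hyperbolic n./2 f (polar_hyperplane f P).

Definition internal f P : bool :=
  ~~ on_quadric f P && ~~ hyperbolic n./2 f (polar_hyperplane f P).

Definition num_external_internal f g : nat :=
  #|[set P in proj_space | external f P && internal g P]|.

End Quadrics.

(* Main.v *)
Require Import Defs.
From HB Require Import structures.
From mathcomp Require Import all_boot all_order all_algebra.
From mathcomp Require Import mpoly.
From mathcomp Require Import zify ring lra.

Set Implicit Arguments.
Unset Strict Implicit.
Unset Printing Implicit Defensive.

Import Order.TTheory GRing.Theory Num.Theory.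
Local Open Scope ring_scope.

(** Let m = n / 2, let q be the order of F, and let chi be its quadratic
    character.

    A smooth form f in 2m + 1 variables over F is an orthogonal sum of m
    hyperbolic planes and a line spanned by a vector of some nonzero value d0.
    So some line off the quadric has a hyperbolic polar hyperplane. Reflections and
    -1 act transitively on the vectors of a given nonzero value, hence every vector
    whose value is d0 times a square is external as well; conversely the sizes of
    the level sets of f determine d0 up to squares. This yields a constant d with:
    the point [x] is external when chi(d f(x)) = 1 and internal when it is -1
    ([external_internal_qchar]). With the constant d' for g, a vector x off both
    quadrics is therefore counted with weight
      (1 + chi(d f(x))) (1 - chi(d' g(x))) / 4,
    and N is the sum of these weights divided by q - 1.

    Expanding, the main term is q^(n+1) / 4, and three character sums remain.
    The sums of chi(d f) and of chi(d' g) are read off from the sizes of the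
    level sets ([sum_qchar_form]). For the sum of chi(f g), sort the vectors by
    the ratio t = g / f: it becomes the sum over t of chi(t) N_t, where N_t is the
    number of zeros of the member g - t f of the pencil
    ([sum_qchar_pencil]); the base locus f = g = 0 contributes the same amount
    to every N_t and cancels, because chi sums to zero. A nondegenerate form in
    an odd number of variables has exactly q^n zeros, so again by cancellation
    only the degenerate members count. There are at most n + 1 of them, the roots
    of a characteristic polynomial, and each has at most 2 q^n zeros. All
    error terms are thus O(q^n) before the division by q - 1, which gives
    |N - q^n / 4| <= (n + 8) q^(n-1). *)

(** * The quadratic character *)

(** Translation by 1 permutes F, so comparing the sum of all elements with that
    of their translates gives q = 0 in F; if 2 = 0, an odd q would be 1. *)
Lemma odd_card_two_neq0 (F : finFieldType) : odd #|F| -> 2%:R != 0 :> F.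
Proof.
move=> odd_q; apply/eqP => two0.
have q0 : #|F|%:R = 0 :> F.
  have /esym/eqP : \sum_(a : F) a = \sum_(a : F) (a + 1) by exact: reindex_inj (addIr 1).
  by rewrite big_split /= sumr_const -subr_eq0 addrAC subrr add0r => /eqP.
move/eqP: q0; rewrite -(odd_double_half #|F|) odd_q natrD -mul2n natrM two0.
by rewrite mul0r addr0 oner_eq0.
Qed.

Section QuadraticCharacter.

Variable F : finFieldType.
Hypothesis odd_q : odd #|F|.

Let two0 : 2%:R != 0 :> F := odd_card_two_neq0 odd_q.

(** The quadratic character with values in int: an element has 1 + chi(a) square
    roots. *)
Definition qchar (a : F) : int := #|[set c : F | c ^+ 2 == a]|%:Z - 1.

Lemma qchar_sqr (c : F) : c != 0 -> qchar (c ^+ 2) = 1.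
Proof.
move=> c0; rewrite /qchar.
have -> : [set d | d ^+ 2 == c ^+ 2] = [set c; - c].
  by apply/setP=> d; rewrite !inE eqf_sqr.
rewrite cards2.
have cNc : c != - c by rewrite -subr_eq0 opprK -mulr2n -mulr_natl mulf_neq0.
by rewrite cNc.
Qed.

Lemma qchar0 : qchar 0 = 0.
Proof.
rewrite /qchar.
have -> : [set d : F | d ^+ 2 == 0] = [set 0].
  by apply/setP=> d; rewrite !inE sqrf_eq0.
by rewrite cards1.
Qed.

Lemma qchar_nonsquare (a : F) : (forall c, a != c ^+ 2) -> qchar a = -1.
Proof.
move=> nsq; rewrite /qchar.
have -> : [set d | d ^+ 2 == a] = set0.
  by apply/setP=> d; rewrite !inE eq_sym (negbTE (nsq d)).
by rewrite cards0.
Qed.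

Variant qchar_spec (a : F) : int -> Type :=
| QcharZero of a = 0 : qchar_spec a 0
| QcharSquare c of c != 0 & a = c ^+ 2 : qchar_spec a 1
| QcharNonsquare of a != 0 & (forall c, a != c ^+ 2) : qchar_spec a (-1).

Lemma qcharP a : qchar_spec a (qchar a).
Proof.
have [->|a0] := eqVneq a 0; first by rewrite qchar0; constructor.
have [/existsP/sigW[c /eqP Ea]|] := boolP [exists c, a == c ^+ 2].
  have c0 : c != 0 by move: a0; rewrite Ea sqrf_eq0.
  by rewrite {2}Ea qchar_sqr //; apply: QcharSquare Ea.
rewrite negb_exists => /forallP nsq.
by rewrite (qchar_nonsquare nsq); constructor.
Qed.

Lemma normr_qchar_le1 a : `|qchar a| <= 1.
Proof. by case: qcharP. Qed.

Lemma sum_qchar : \sum_a qchar a = 0.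
Proof.
rewrite sumrB sumr_const -(big_morph Posz PoszD (erefl _)).
under eq_bigr => a _ do rewrite -sum1_card.
rewrite (exchange_big_dep predT) //=.
under eq_bigr => c _ do under eq_bigl => a do rewrite inE eq_sym.
under eq_bigr => c _ do rewrite big_pred1_eq.
by rewrite sum1_card natz subrr.
Qed.

Lemma sum_qchar_scale a : a != 0 -> \sum_t qchar (a * t) = 0.
Proof. by move=> a0; rewrite -[RHS]sum_qchar [RHS](reindex_inj (mulfI a0)). Qed.

Lemma qcharM_sqr a c : c != 0 -> qchar (a * c ^+ 2) = qchar a.
Proof.
move=> c0; have [->|d d0 ->|a0 nsq] := qcharP a; first by rewrite mul0r qchar0.
  by rewrite -exprMn qchar_sqr ?mulf_neq0.
apply: qchar_nonsquare => d; apply: contra_neq (nsq (d / c)) => E.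
by rewrite exprMn -E exprVn mulfK ?expf_neq0.
Qed.

(** For a nonsquare a, each sum chi(a t) + chi(t) is nonpositive: it vanishes
    when t is a square and is at most 1 - 1 otherwise. Summed over t they cancel,
    so all of them vanish; this makes nonsquare times nonsquare a square. *)
Lemma qcharM a b : qchar (a * b) = qchar a * qchar b.
Proof.
have [->|c c0 ->|a0 nsq] := qcharP a; first by rewrite !mul0r qchar0.
  by rewrite mulrC qcharM_sqr ?mul1r.
have le0 t : qchar (a * t) + qchar t <= 0.
  case: (qcharP t) => [->|c c0 ->|t0 nsqt]; first by rewrite mulr0 qchar0.
    by rewrite qcharM_sqr // qchar_nonsquare.
  by rewrite subr_le0; have := normr_qchar_le1 (a * t); rewrite ler_norml => /andP[].
have /psumr_eq0P sum0 : forall t, true -> 0 <= - (qchar (a * t) + qchar t).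
  by move=> t _; rewrite oppr_ge0.
have : \sum_t - (qchar (a * t) + qchar t) = 0.
  by rewrite sumrN big_split /= sum_qchar_scale // sum_qchar addr0 oppr0.
move=> /sum0 /(_ b isT) /eqP; rewrite oppr_eq0 addr_eq0 => /eqP ->.
by rewrite mulN1r.
Qed.

End QuadraticCharacter.

(** * Quadratic forms and their pencils *)

Section GramMatrix.

Variables (F : finFieldType) (n : nat).
Hypothesis two0 : 2%:R != 0 :> F.
Local Notation V := 'rV[F]_n.+1.
Implicit Types (f g : {mpoly F[n.+1]}) (x y z : V) (A : 'M[F]_n.+1).

(** The form x A x^T as a polynomial; Gram matrices give access to linear
    algebra for polar forms and to their degeneracy. *)
Definition quadratic_poly A : {mpoly F[n.+1]} :=
  \sum_i \sum_j A i j *: ('X_i * 'X_j).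

Lemma quadratic_poly0 : quadratic_poly 0 = 0.
Proof.
by rewrite /quadratic_poly big1 // => i _; rewrite big1 // => j _; rewrite mxE scale0r.
Qed.

Lemma quadratic_polyD A A' :
  quadratic_poly (A + A') = quadratic_poly A + quadratic_poly A'.
Proof.
rewrite -big_split; apply: eq_bigr => i _; rewrite -big_split.
by apply: eq_bigr => j _; rewrite mxE scalerDl.
Qed.

Lemma quadratic_polyZ a A : quadratic_poly (a *: A) = a *: quadratic_poly A.
Proof.
rewrite scaler_sumr; apply: eq_bigr => i _; rewrite scaler_sumr.
by apply: eq_bigr => j _; rewrite mxE scalerA.
Qed.

Lemma quadratic_poly_delta i j : quadratic_poly (delta_mx i j) = 'X_i * 'X_j.
Proof.
rewrite /quadratic_poly (bigD1 i) //= (bigD1 j) //= !mxE !eqxx scale1r.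
rewrite big1 => [|j' /negbTE nj]; last by rewrite mxE nj andbF scale0r.
rewrite big1 ?addr0 // => i' /negbTE ni; rewrite big1 // => j' _.
by rewrite mxE ni scale0r.
Qed.

Lemma mdeg_eq2 (m : 'X_{1.. n.+1}) : mdeg m = 2%N ->
  exists i j, m = (U_(i) + U_(j))%MM.
Proof.
move=> deg_m; have [i mi] : exists i, (0 < m i)%N.
  apply/existsP; apply: contra_eqT deg_m; rewrite negb_exists => /forallP m0.
  by rewrite mdegE big1 // => i _; apply/eqP; rewrite -leqn0 leqNgt.
have le_im : (U_(i) <= m)%MM by rewrite lep1mP -lt0n.
have /mdeg1P[j /eqP Em] : mdeg (m - U_(i)) == 1%N.
  by have := congr1 mdeg (submK le_im); rewrite mdegD mdeg1 deg_m addn1 => -[->].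
by exists i, j; rewrite -Em addmC submK.
Qed.

(** The symmetric matrix of a monomial X_i X_j is half the sum of the two
    elementary matrices, which is where odd characteristic enters. *)
Lemma homog2_gram f : f \is 2.-homog -> exists2 A, A^T = A & f = quadratic_poly A.
Proof.
move=> /dhomogP homf; rewrite (mpolyE f) big_seq.
apply: (big_ind (fun g => exists2 A, A^T = A & g = quadratic_poly A)).
- by exists 0; rewrite ?trmx0 ?quadratic_poly0.
- move=> _ _ [A trA ->] [A' trA' ->]; exists (A + A').
    by rewrite linearD /= trA trA'.
  by rewrite quadratic_polyD.
move=> m /homf /mdeg_eq2 [i [j ->]].
exists ((f@_(U_(i) + U_(j)) / 2%:R) *: (delta_mx i j + delta_mx j i)).
  by rewrite linearZ linearD /= !trmx_delta addrC.
rewrite quadratic_polyZ quadratic_polyD !quadratic_poly_delta mpolyXD.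
by rewrite ['X_j * _]mulrC -mulr2n -scaler_nat scalerA mulfVK.
Qed.

Lemma evalf_quadratic A x : evalf (quadratic_poly A) x = (x *m A *m x^T) 0 0.
Proof.
rewrite /evalf /quadratic_poly raddf_sum /= mxE.
under eq_bigr => i _ do rewrite raddf_sum /=.
rewrite exchange_big /=; apply: eq_bigr => j _; rewrite !mxE mulr_suml.
by apply: eq_bigr => i _; rewrite mevalZ mevalM !mevalXU mulrCA mulrA.
Qed.

Lemma polar_quadratic A x y : A^T = A ->
  polar (quadratic_poly A) x y = 2%:R * (x *m A *m y^T) 0 0.
Proof.
move=> trA; rewrite /polar !evalf_quadratic.
have trE : (y *m A *m x^T) 0 0 = (x *m A *m y^T) 0 0.
  suff <- : (x *m A *m y^T)^T = y *m A *m x^T by rewrite mxE.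
  by rewrite !trmx_mul trmxK trA mulmxA.
rewrite [(x + y)^T]linearD !(mulmxDl, mulmxDr).
have mxD (B C : 'M[F]_1) : (B + C) 0 0 = B 0 0 + C 0 0 by rewrite mxE.
rewrite !mxD trE; ring.
Qed.

Lemma evalfZ f a x : f \is 2.-homog -> evalf f (a *: x) = a ^+ 2 * evalf f x.
Proof.
move=> /homog2_gram[A _ ->]; rewrite !evalf_quadratic.
by rewrite [(a *: x)^T]linearZ -!scalemxAl -scalemxAr !mxE expr2 mulrA.
Qed.

Lemma polarC f x y : polar f x y = polar f y x.
Proof. by rewrite /polar [x + y]addrC; ring. Qed.

Lemma polarDr f x y z : f \is 2.-homog ->
  polar f x (y + z) = polar f x y + polar f x z.
Proof.
move=> /homog2_gram[A trA ->]; rewrite !polar_quadratic //.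
by rewrite [(y + z)^T]linearD mulmxDr mxE mulrDr.
Qed.

Lemma polarZr f a x y : f \is 2.-homog -> polar f x (a *: y) = a * polar f x y.
Proof.
move=> /homog2_gram[A trA ->]; rewrite !polar_quadratic //.
by rewrite [(a *: y)^T]linearZ -scalemxAr mxE mulrCA.
Qed.

Lemma polarDl f x y z : f \is 2.-homog ->
  polar f (y + z) x = polar f y x + polar f z x.
Proof. by move=> homf; rewrite polarC polarDr // ![polar f x _]polarC. Qed.

Lemma polarZl f a x y : f \is 2.-homog -> polar f (a *: y) x = a * polar f y x.
Proof. by move=> homf; rewrite polarC polarZr // polarC. Qed.

Lemma polar0r f x : f \is 2.-homog -> polar f x 0 = 0.
Proof. by move=> homf; rewrite -(scale0r 0) polarZr ?mul0r. Qed.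

Lemma polar_sumr f x I (r : seq I) P (u : I -> V) : f \is 2.-homog ->
  polar f x (\sum_(i <- r | P i) u i) = \sum_(i <- r | P i) polar f x (u i).
Proof.
move=> homf; apply: (big_morph (polar f x)) => [y z|]; first exact: polarDr.
exact: polar0r.
Qed.

Lemma polarxx f x : f \is 2.-homog -> polar f x x = 2%:R * evalf f x.
Proof.
move=> homf; rewrite /polar -mulr2n -scaler_nat evalfZ //; ring.
Qed.

Lemma evalfD f x y : evalf f (x + y) = evalf f x + evalf f y + polar f x y.
Proof. by rewrite /polar; ring. Qed.

Lemma evalf0 f : f \is 2.-homog -> evalf f 0 = 0.
Proof. by move=> homf; rewrite -(scale0r 0) evalfZ // expr0n mul0r. Qed.

(** Over a finite field a nonzero polynomial may vanish at every point; a
    quadratic form may not, since the polar form recovers its Gram matrix. *)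
Lemma homog2_eq0 f : f \is 2.-homog -> (forall x, evalf f x = 0) -> f = 0.
Proof.
move=> /homog2_gram[A trA Ef] f0.
suff A0 : A = 0 by rewrite Ef A0 quadratic_poly0.
apply/matrixP=> i j; rewrite mxE.
have /eqP : polar f (delta_mx 0 i) (delta_mx 0 j) = 0.
  by rewrite /polar !f0 !subr0.
rewrite Ef polar_quadratic // mulf_eq0 (negbTE two0) /= => /eqP <-.
by rewrite -rowE trmx_delta -colE !mxE.
Qed.

Lemma card_roots_lt (p : {poly F}) : p != 0 -> (#|[set t | root p t]| < size p)%N.
Proof.
move=> p0; rewrite cardE; apply: max_poly_roots => //; last exact: enum_uniq.
by apply/allP=> t; rewrite mem_enum inE.
Qed.

Lemma card_zeros_on_line f x y : f \is 2.-homog -> evalf f x != 0 ->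
  (#|[set t : F | evalf f (y + t *: x) == 0%R]| <= 2)%N.
Proof.
move=> homf fx0; set p := Poly [:: evalf f y; polar f y x; evalf f x].
have p0 : p != 0 by apply: contraNneq fx0 => Ep; rewrite -(coef0 F 2) -Ep coef_Poly.
rewrite -ltnS; apply: leq_trans (size_Poly [:: evalf f y; polar f y x; evalf f x]).
apply: leq_ltn_trans (card_roots_lt p0); apply/subset_leq_card/subsetP => t.
rewrite !inE rootE horner_Poly /= evalfD evalfZ // polarZr // => /eqP ft0.
by apply/eqP; rewrite -[RHS]ft0; ring.
Qed.

(** Average over the lines parallel to a vector x with f(x) <> 0: restricted to
    such a line f is a polynomial of degree exactly 2, with at most two roots. *)
Lemma zero_form_card_le f : f \is 2.-homog -> f != 0 ->
  (#|[set x | evalf f x == 0%R]| <= 2 * #|F| ^ n)%N.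
Proof.
move=> homf f0; have [x fx0] : exists x, evalf f x != 0.
  apply/existsP; apply: contraNT f0; rewrite negb_exists => /forallP fE.
  by apply/eqP/homog2_eq0 => // x; apply/eqP; rewrite -[_ == _]negbK fE.
have q0 : (0 < #|F|)%N by apply/card_gt0P; exists 0.
have sum_card : (\sum_(t : F) #|[set y : V | evalf f (y + t *: x) == 0%R]| =
    \sum_(y : V) #|[set t : F | evalf f (y + t *: x) == 0%R]|)%N.
  under eq_bigr => t _ do rewrite -sum1_card.
  under [RHS]eq_bigr => t _ do rewrite -sum1_card.
  rewrite (exchange_big_dep predT) //=; apply: eq_bigr => y _.
  by apply: eq_bigl => t; rewrite !inE.
rewrite -(leq_pmul2l q0) -[X in (X * _ <= _)%N]/#|predT|.
apply: leq_trans (_ : \sum_(y : V) 2 <= _)%N; last first.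
  by rewrite sum_nat_const card_mx mul1n expnS [(2 * _)%N]mulnC mulnA.
apply: leq_trans (leq_sum _ (fun y _ => card_zeros_on_line y homf fx0)).
rewrite -sum_card -sum_nat_const leq_eqVlt; apply/orP; left; apply/eqP.
symmetry; apply: eq_bigr => t _.
have addI : injective (fun y : V => y + t *: x) := addIr _.
rewrite -[RHS](card_preimset _ addI).
by apply: eq_card => y; rewrite !inE.
Qed.

(** With Gram matrices A and B, a vector in the kernel of B - t A is an
    eigenvector of B A^-1 for t. *)
Lemma card_degenerate_pencil f g : smooth_quadric f -> g \is 2.-homog ->
  exists2 s : {set F}, (#|s| <= n.+1)%N &
    forall t, t \notin s -> Defs.nondegenerate (g - t *: f).
Proof.
move=> [homf ndf] /homog2_gram[B trB ->].
have [A trA Ef] := homog2_gram homf; rewrite Ef in ndf *.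
have mx_eq0 (M : 'M[F]_n.+1) x : (forall y, 2%:R * (x *m M *m y^T) 0 0 = 0) -> x *m M = 0.
  move=> xM; apply/rowP=> j; rewrite [RHS]mxE; move: (xM (delta_mx 0 j)) => /eqP.
  rewrite mulf_eq0 (negbTE two0) /= => /eqP <-.
  by rewrite trmx_delta -colE [RHS]mxE.
have Aunit : A \in unitmx.
  rewrite -row_free_unit -kermx_eq0; apply/rowV0P => x /sub_kermxP xA.
  by apply: ndf => y; rewrite polar_quadratic // xA mul0mx mxE mulr0.
exists [set t | root (char_poly (B *m invmx A)) t].
  rewrite -ltnS -[X in (_ < X)%N](size_char_poly (B *m invmx A)).
  by rewrite card_roots_lt // monic_neq0 ?char_poly_monic.
move=> t; rewrite inE -eigenvalue_root_char => /eigenvalueP noteig x xperp.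
apply/eqP/negPn/negP => x0; apply: noteig; exists x => //.
have E : quadratic_poly B - t *: quadratic_poly A = quadratic_poly (B - t *: A).
  by rewrite -scaleNr -quadratic_polyZ -quadratic_polyD scaleNr.
have trBA : (B - t *: A)^T = B - t *: A by rewrite linearB linearZ /= trA trB.
have /mx_eq0/eqP : forall y, 2%:R * (x *m (B - t *: A) *m y^T) 0 0 = 0.
  by move=> y; rewrite -polar_quadratic // -E.
rewrite mulmxBr subr_eq0 => /eqP xB.
by rewrite mulmxA xB -scalemxAr -scalemxAl mulmxK.
Qed.

End GramMatrix.

(** * Witt decomposition *)

(** Were c not represented, (c - b s) / a would be a nonsquare for every square
    s, so chi(s) + chi((c - b s) / a) would be nonpositive for all s, and
    negative at s = 0. But the sum of this over s is zero. *)
Lemma sum_two_squares_onto (F : finFieldType) (a b c : F) : odd #|F| ->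
  a != 0 -> b != 0 -> exists x y, a * x ^+ 2 + b * y ^+ 2 = c.
Proof.
move=> odd_q a0 b0.
have [/existsP[x /existsP[y /eqP E]]|] :=
  boolP [exists x, exists y, a * x ^+ 2 + b * y ^+ 2 == c].
  by exists x, y.
rewrite negb_exists => /forallP noE.
have nsq y : qchar ((c - b * y ^+ 2) / a) = -1.
  apply: qchar_nonsquare => x; have := noE x; rewrite negb_exists => /forallP /(_ y).
  apply: contraNneq => E; have -> : x ^+ 2 = (c - b * y ^+ 2) / a by [].
  by rewrite mulrC divfK // subrK.
have le0 s : qchar s + qchar ((c - b * s) / a) <= 0.
  case: (qcharP odd_q s) => [->|y y0 ->|s0 _]; last 1 first.
  - by rewrite addrC subr_le0; have := normr_qchar_le1 odd_q ((c - b * s) / a);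
      rewrite ler_norml => /andP[].
  - by have := nsq 0; rewrite expr0n /= => ->.
  - by rewrite nsq.
have aff_inj : injective (fun s => (c - b * s) / a).
  by move=> s s' /(mulIf (invr_neq0 a0)) /addrI /oppr_inj /(mulfI b0).
have : \sum_s - (qchar s + qchar ((c - b * s) / a)) = 0.
  have sum_aff : \sum_s qchar ((c - b * s) / a) = 0.
    by rewrite -[RHS](sum_qchar F) [RHS](reindex_inj aff_inj).
  by rewrite sumrN big_split /= sum_aff sum_qchar.
have /psumr_eq0P sum0 : forall s, true -> 0 <= - (qchar s + qchar ((c - b * s) / a)).
  by move=> s _; rewrite oppr_ge0.
move=> /sum0 /(_ 0 isT); have := nsq 0.
by rewrite expr0n /= mulr0 => ->; rewrite qchar0.
Qed.

Section WittDecomposition.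

Variables (F : finFieldType) (n : nat).
Hypothesis odd_q : odd #|F|.
Let two0 : 2%:R != 0 :> F := odd_card_two_neq0 odd_q.
Local Notation V := 'rV[F]_n.+1.
Variable f : {mpoly F[n.+1]}.
Hypothesis smooth_f : smooth_quadric f.
Let homf : f \is 2.-homog := proj1 smooth_f.
Let ndf : Defs.nondegenerate f := proj2 smooth_f.
Implicit Types (x y z u : V).

Definition hyperbolic_pairs k (e h : 'I_k -> V) : Prop :=
  [/\ forall i, evalf f (e i) = 0, forall i, evalf f (h i) = 0,
      forall i j, polar f (e i) (e j) = 0, forall i j, polar f (h i) (h j) = 0
    & forall i j, polar f (e i) (h j) = (i == j)%:R].

Definition orth_pairs k (e h : 'I_k -> V) x : Prop :=
  forall i, polar f (e i) x = 0 /\ polar f (h i) x = 0.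

(** There are fewer linear conditions than coordinates. *)
Lemma orthogonal_vector (s : seq V) : (size s <= n)%N ->
  exists2 x, x != 0 & forall v, v \in s -> polar f v x = 0.
Proof.
move=> les; set M := \matrix_(i < n.+1, j < size s) polar f s`_j (delta_mx 0 i).
have : kermx M != 0.
  rewrite kermx_eq0 /row_free neq_ltn; apply/orP; left.
  by rewrite ltnS (leq_trans (rank_leq_col M)).
move=> /rowV0Pn[x /sub_kermxP xM x0]; exists x => // v /(nthP 0)[j jlt <-].
have := congr1 (fun w : 'rV_(size s) => w 0 (Ordinal jlt)) xM; rewrite [RHS]mxE => <-.
rewrite {1}[x]row_sum_delta polar_sumr // mxE; apply: eq_bigr => i _.
by rewrite polarZr // mxE.
Qed.

(** Among three mutually orthogonal vectors with nonzero values, the first two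
    span a plane representing every value, in particular the opposite of the value
    of the third. *)
Lemma isotropic_vector k (e h : 'I_k -> V) : (2 * k + 2 <= n)%N ->
  exists x, [/\ x != 0, evalf f x = 0 & orth_pairs e h x].
Proof.
move=> le_n.
have ext (t : seq V) : (size t <= 2)%N -> exists x,
    [/\ x != 0, orth_pairs e h x & forall v, v \in t -> polar f v x = 0].
  move=> size_t; have [|x x0 perp] := @orthogonal_vector (codom e ++ codom h ++ t).
    by rewrite !size_cat !size_codom card_ord; lia.
  exists x; split=> // [i|v vt]; last by rewrite perp // !mem_cat vt !orbT.
  by rewrite !perp // !mem_cat ?codom_f ?orbT.
have [//|u1 [u10 orth1 _]] := ext [::].
have [f1|f1] := eqVneq (evalf f u1) 0; first by exists u1.
have [//|u2 [u20 orth2 perp2]] := ext [:: u1].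
have [f2|f2] := eqVneq (evalf f u2) 0; first by exists u2.
have [//|u3 [u30 orth3 perp3]] := ext [:: u1; u2].
have [f3|f3] := eqVneq (evalf f u3) 0; first by exists u3.
have p12 : polar f u1 u2 = 0 by rewrite perp2 ?inE ?eqxx.
have p13 : polar f u1 u3 = 0 by rewrite perp3 ?inE ?eqxx.
have p23 : polar f u2 u3 = 0 by rewrite perp3 ?inE ?eqxx ?orbT.
have [a [b Eab]] := sum_two_squares_onto (- evalf f u3) odd_q f1 f2.
exists (a *: u1 + b *: u2 + u3); split.
- apply: contraNneq f3 => E0; have := polar0r two0 u3 homf.
  rewrite -E0 polarC !polarDl // !polarZl // p13 p23 !mulr0 !add0r polarxx //.
  by move/eqP; rewrite mulf_eq0 (negbTE two0).
- rewrite !evalfD // !evalfZ // polarDl // !polarZl // !polarZr // p12 p13 p23.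
  by rewrite !mulr0 !addr0 mulrC [b ^+ 2 * _]mulrC Eab addNr.
- move=> i; have [e1 h1] := orth1 i; have [e2 h2] := orth2 i.
  have [e3 h3] := orth3 i.
  by rewrite !polarDr // !polarZr // e1 h1 e2 h2 e3 h3 !mulr0 !addr0.
Qed.

Definition pair_comb k (e h : 'I_k -> V) (a b : 'I_k -> F) : V :=
  \sum_i (a i *: e i + b i *: h i).

Lemma polar_pair_comb k (e h : 'I_k -> V) a b y :
  polar f (pair_comb e h a b) y = \sum_i (a i * polar f (e i) y + b i * polar f (h i) y).
Proof.
rewrite polarC polar_sumr //; apply: eq_bigr => i _.
by rewrite polarDr // !polarZr // ![polar f y _]polarC.
Qed.

Lemma polar_pair_comb_orth k (e h : 'I_k -> V) a b y :
  orth_pairs e h y -> polar f (pair_comb e h a b) y = 0.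
Proof.
move=> orthy; rewrite polar_pair_comb big1 // => i _.
by have [-> ->] := orthy i; rewrite !mulr0 addr0.
Qed.

Section FixedPairs.

Variables (k : nat) (e h : 'I_k -> V).
Hypothesis pairs : hyperbolic_pairs e h.

Lemma polar_pair_combr a b i : polar f (pair_comb e h a b) (h i) = a i.
Proof.
have [_ _ _ hh eh] := pairs; rewrite polar_pair_comb (bigD1 i) //= big1 => [|j nj].
  by rewrite eh hh eqxx mulr1 mulr0 !addr0.
by rewrite eh hh (negbTE nj) !mulr0 addr0.
Qed.

Lemma polar_pair_combl a b i : polar f (pair_comb e h a b) (e i) = b i.
Proof.
have [_ _ ee _ eh] := pairs; rewrite polar_pair_comb (bigD1 i) //= big1 => [|j nj].
  by rewrite ee [polar f (h i) _]polarC eh eqxx mulr1 mulr0 addr0 add0r.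
by rewrite ee [polar f (h j) _]polarC eh eq_sym (negbTE nj) !mulr0 addr0.
Qed.

(** In a hyperbolic pair the coordinate along e is the product with h, and
    conversely. *)
Lemma orth_projection y :
  orth_pairs e h
    (y - pair_comb e h (fun i => polar f y (h i)) (fun i => polar f y (e i))).
Proof.
move=> i; rewrite -scaleN1r !polarDr // !polarZr //.
rewrite ![polar f _ (pair_comb _ _ _ _)]polarC polar_pair_combl polar_pair_combr.
by rewrite ![polar f y _]polarC !mulN1r !subrr.
Qed.

(** Project a vector that is not orthogonal to x away from the given pairs, then
    correct it along x, which changes its value but not its product with x. *)
Lemma hyperbolic_partner x : orth_pairs e h x -> x != 0 -> evalf f x = 0 ->
  exists y, [/\ orth_pairs e h y, evalf f y = 0 & polar f x y = 1].
Proof.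
move=> orthx x0 fx0; have [y xy] : exists y, polar f x y != 0.
  apply/existsP; apply: contraNT x0; rewrite negb_exists => /forallP xy.
  by apply/eqP/ndf => y; apply/eqP; rewrite -[_ == _]negbK xy.
set c := polar f x y in xy.
set z := y - pair_comb e h (fun i => polar f y (h i)) (fun i => polar f y (e i)).
have orthz : orth_pairs e h z := orth_projection y.
have xz : polar f x z = c.
  rewrite /z -scaleN1r polarDr // polarZr // [polar f x (pair_comb _ _ _ _)]polarC.
  by rewrite polar_pair_comb_orth // mulr0 addr0.
exists (c^-1 *: z + (- evalf f z / c ^+ 2) *: x); split.
- move=> i; have [ez hz] := orthz i; have [ex hx] := orthx i.
  by rewrite !polarDr // !polarZr // ez hz ex hx !mulr0 addr0.
- rewrite evalfD !evalfZ // polarZl // polarZr // [polar f z x]polarC xz fx0.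
  by field.
- rewrite polarDr // !polarZr // xz polarxx // fx0 !mulr0 addr0.
  by rewrite mulVf.
Qed.

End FixedPairs.

Lemma extend_pairs k (e h : 'I_k -> V) : (2 * k + 2 <= n)%N ->
  hyperbolic_pairs e h -> exists e' h' : 'I_k.+1 -> V, hyperbolic_pairs e' h'.
Proof.
move=> le_n pairs; have [x [x0 fx orthx]] := isotropic_vector e h le_n.
have [y [orthy fy xy]] := hyperbolic_partner pairs orthx x0 fx.
have [fe fh ee hh eh] := pairs.
exists (fun i => if unlift ord0 i is Some j then e j else x).
exists (fun i => if unlift ord0 i is Some j then h j else y).
have ox i : polar f (e i) x = 0 /\ polar f (h i) x = 0 by [].
have oy i : polar f (e i) y = 0 /\ polar f (h i) y = 0 by [].
split=> [i|i|i j|i j|i j]; case: (unliftP ord0 i) => [i'|] Ei //;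
  try case: (unliftP ord0 j) => [j'|] Ej //.
- by case: (ox i').
- by rewrite polarC; case: (ox j').
- by rewrite polarxx // fx mulr0.
- by case: (oy i').
- by rewrite polarC; case: (oy j').
- by rewrite polarxx // fy mulr0.
- by rewrite Ei Ej eh (inj_eq lift_inj).
- by rewrite Ei Ej; case: (oy i').
- by rewrite Ei Ej polarC; case: (ox j').
- by rewrite Ei Ej.
Qed.

Lemma exists_pairs k : (2 * k <= n)%N ->
  exists e h : 'I_k -> V, hyperbolic_pairs e h.
Proof.
elim: k => [|k IHk] le_n; first by exists (fun _ => 0), (fun _ => 0); split=> -[].
have [|e [h pairs]] := IHk; first by lia.
by apply: extend_pairs pairs; lia.
Qed.

Section Frame.

Variables (m : nat) (e h : 'I_m -> V) (x : V).
Hypotheses (dim : n = (2 * m)%N) (pairs : hyperbolic_pairs e h).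
Hypotheses (orthx : orth_pairs e h x) (x0 : x != 0).

(** Coordinates in which f reads a_1 b_1 + ... + a_m b_m + c^2 f(x). *)
Definition frame (p : {ffun 'I_m -> F} * {ffun 'I_m -> F} * F) : V :=
  pair_comb e h p.1.1 p.1.2 + p.2 *: x.

Lemma polar_frame p : polar f x (frame p) = p.2 * (2%:R * evalf f x).
Proof.
by rewrite polarDr // polarC polar_pair_comb_orth // add0r polarZr // polarxx.
Qed.

(** The products with the vectors of the pairs recover a and b, hence c: the map
    is injective, and it is bijective because both sides have q^(2m+1) elements. *)
Lemma frame_bij : bijective frame.
Proof.
apply: inj_card_bij; last first.
  by rewrite card_mx !card_prod !card_ffun !card_ord mul1n dim -expnD addnn mul2n expnSr.
move=> [[a b] c] [[a' b'] c'] Ep.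
have polarp (p : {ffun 'I_m -> F} * {ffun 'I_m -> F} * F) i :
    polar f (frame p) (h i) = p.1.1 i /\ polar f (frame p) (e i) = p.1.2 i.
  rewrite /frame !polarDl // !polarZl // ![polar f x _]polarC.
  have [-> ->] := orthx i.
  by rewrite polar_pair_combr // polar_pair_combl // mulr0 !addr0.
have Ea : a = a'.
  apply/ffunP=> i; have [<- _] := polarp (a, b, c) i; rewrite Ep.
  by have [-> _] := polarp (a', b', c') i.
have Eb : b = b'.
  apply/ffunP=> i; have [_ <-] := polarp (a, b, c) i; rewrite Ep.
  by have [_ ->] := polarp (a', b', c') i.
move: Ep; rewrite Ea Eb /frame /= => /addrI /eqP.
by rewrite -subr_eq0 -scalerBl scaler_eq0 (negbTE x0) orbF subr_eq0 => /eqP ->.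
Qed.

Lemma evalf_frame p : evalf f (frame p) = \sum_i p.1.1 i * p.1.2 i + p.2 ^+ 2 * evalf f x.
Proof.
rewrite evalfD // evalfZ // polarZr // polar_pair_comb_orth // mulr0 addr0.
congr (_ + _); apply: (mulfI two0); rewrite -polarxx // polar_pair_comb.
rewrite mulr_sumr; apply: eq_bigr => i _; rewrite ![polar f _ (pair_comb _ _ _ _)]polarC.
by rewrite polar_pair_combl // polar_pair_combr //; ring.
Qed.

Lemma evalf_orth_neq0 : evalf f x != 0.
Proof.
apply: contraNneq x0 => fx0; apply/eqP/ndf => y; have [g _ gK] := frame_bij.
by rewrite -(gK y) polar_frame fx0 !mulr0.
Qed.

End Frame.

End WittDecomposition.

(** * Level sets and square classes *)

Lemma card_set_sum (T : finType) (p : pred T) :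
  #|[set x | p x]|%:Z = \sum_x (p x)%:R.
Proof.
rewrite -sum1dep_card (big_morph Posz PoszD (erefl _)) big_mkcond.
by apply: eq_bigr => x _; case: (p x).
Qed.

Lemma PoszX (a k : nat) : a%:Z ^+ k = (a ^ k)%N.
Proof. by elim: k => // k IHk; rewrite exprS expnS PoszM IHk. Qed.

Section DotProduct.

Variables (F : finFieldType) (m : nat).
Implicit Types (a b : {ffun 'I_m -> F}).

(** All level sets of a nonzero linear form are translates of each other. *)
Lemma card_dot_eq a i r s : a i != 0 ->
  #|[set b : {ffun 'I_m -> F} | \sum_j a j * b j == r]| =
  #|[set b : {ffun 'I_m -> F} | \sum_j a j * b j == s]|.
Proof.
move=> ai0; pose shift (b : {ffun 'I_m -> F}) :=
  [ffun j => b j + (j == i)%:R * ((s - r) / a i)].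
have shift_inj : injective shift.
  by move=> b b' /ffunP E; apply/ffunP=> j; have := E j; rewrite !ffunE => /addIr.
rewrite -(card_preimset [set b : {ffun 'I_m -> F} | \sum_j a j * b j == s] shift_inj).
apply: eq_card => b; rewrite !inE.
have -> : \sum_j a j * shift b j = \sum_j a j * b j + (s - r).
  under eq_bigr => j _ do rewrite ffunE mulrDr.
  rewrite big_split /=; congr (_ + _); rewrite (bigD1 i) //= eqxx mul1r big1 => [|j nj].
    by rewrite addr0 mulrC divfK.
  by rewrite (negbTE nj) mul0r mulr0.
by rewrite -subr_eq0 -[in RHS]subr_eq0; congr (_ == 0); ring.
Qed.

(** Having equal sizes, the level sets may be counted at any sequence of q levels
    in place of the q distinct ones, whose union is everything. *)
Lemma sum_card_dot a (r : F -> F) : a != 0 ->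
  (\sum_c #|[set b : {ffun 'I_m -> F} | (\sum_j a j * b j)%R == r c]| = #|F| ^ m)%N.
Proof.
move=> a0; have [i ai0] : exists i, a i != 0.
  apply/existsP; apply: contraNT a0; rewrite negb_exists => /forallP a0.
  by apply/eqP/ffunP=> i; rewrite ffunE; apply/eqP; rewrite -[_ == _]negbK a0.
under eq_bigr => c _ do rewrite (card_dot_eq (r c) c ai0).
under eq_bigr => c _ do rewrite -sum1_card.
rewrite (exchange_big_dep predT) //=.
under eq_bigr => b _ do under eq_bigl => c do rewrite inE eq_sym.
under eq_bigr => b _ do rewrite big_pred1_eq.
by rewrite sum1_card card_ffun card_ord.
Qed.

End DotProduct.

Section LevelSets.

Variables (F : finFieldType) (n m : nat).
Hypothesis odd_q : odd #|F|.
Let two0 : 2%:R != 0 :> F := odd_card_two_neq0 odd_q.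
Local Notation V := 'rV[F]_n.+1.
Hypothesis dim : n = (2 * m)%N.
Variable f : {mpoly F[n.+1]}.
Hypothesis smooth_f : smooth_quadric f.
Let homf : f \is 2.-homog := proj1 smooth_f.
Implicit Types (x y z u : V).

(** In the coordinates of a frame, let a be the coordinates along the e_i. If a is
    nonzero, summing over c and b gives q^m by [sum_card_dot], whatever s is. If a
    is zero, b is free and c must be a square root of s / f(x). *)
Lemma card_level_set (e h : 'I_m -> V) x s : hyperbolic_pairs f e h ->
  orth_pairs f e h x -> x != 0 ->
  #|[set v : V | evalf f v == s]|%:Z =
    #|F|%:Z ^+ n + #|F|%:Z ^+ m * qchar (s * evalf f x).
Proof.
move=> pairs orthx x0; have d0 := evalf_orth_neq0 odd_q smooth_f dim pairs orthx x0.
set d := evalf f x in d0 *.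
have frameB := frame_bij odd_q smooth_f dim pairs orthx x0.
rewrite -(on_card_preimset (onW_bij _ frameB)).
pose coords := ({ffun 'I_m -> F} * {ffun 'I_m -> F} * F)%type.
pose level := [set p : coords | \sum_i p.1.1 i * p.1.2 i == s - p.2 ^+ 2 * d].
have -> : frame e h x @^-1: [set v | evalf f v == s] = level.
  apply/setP=> p; rewrite !inE (evalf_frame odd_q smooth_f pairs orthx).
  by rewrite eq_sym -subr_eq eq_sym.
have cardE : (#|level| = \sum_(a : {ffun 'I_m -> F}) \sum_c
    #|[set b : {ffun 'I_m -> F} | (\sum_i a i * b i == s - c ^+ 2 * d)%R]|)%N.
  under [RHS]eq_bigr => a _.
    under eq_bigr => c _ do rewrite -sum1dep_card big_mkcond.
    rewrite exchange_big /=; over.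
  by rewrite -sum1dep_card big_mkcond pair_bigA pair_bigA.
rewrite {}cardE (bigD1 (0 : {ffun 'I_m -> F})) //=.
under [X in (_ + X)%N]eq_bigr => a a0 do rewrite (sum_card_dot _ a0).
have dsq : s / d * d ^+ 2 = s * d by rewrite expr2 mulrA divfK.
rewrite sum_nat_const -dsq qcharM_sqr //.
have card_c c : #|[set b : {ffun 'I_m -> F} |
    \sum_i (0 : {ffun 'I_m -> F}) i * b i == s - c ^+ 2 * d]| =
    ((c ^+ 2 == s / d) * #|F| ^ m)%N.
  have -> : (c ^+ 2 == s / d) = (0 == s - c ^+ 2 * d).
    rewrite eq_sym [in RHS]eq_sym subr_eq0.
    by apply/eqP/eqP => [<-|->]; rewrite ?divfK ?mulfK.
  have E b : \sum_i (0 : {ffun 'I_m -> F}) i * b i = 0.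
    by rewrite big1 // => i _; rewrite ffunE mul0r.
  case: eqVneq => [<-|ne].
    rewrite mul1n -[in RHS](card_ord m) -card_ffun -cardsT; apply: eq_card => b.
    by rewrite !inE E eqxx.
  by rewrite mul0n; apply: eq_card0 => b; rewrite !inE E (negbTE ne).
under eq_bigr => c _ do rewrite card_c.
rewrite -big_distrl /=.
have -> : (\sum_(c : F) (c ^+ 2 == s / d)%R)%N = #|[set c | c ^+ 2 == s / d]|.
  by rewrite -sum1dep_card [RHS]big_mkcond.
rewrite (cardC1 (0 : {ffun 'I_m -> F})) card_ffun card_ord.
have Q0 : (0 < #|F| ^ m)%N.
  by rewrite expn_gt0; apply/orP; left; apply/card_gt0P; exists 0.
rewrite /qchar dim mul2n -addnn exprD !PoszX PoszD !PoszM predn_int //; ring.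
Qed.

(** * External and internal points *)

Definition line x : {set V} := [set a *: x | a : F].

Lemma mem_line x : x \in line x.
Proof. by apply/imsetP; exists 1; rewrite ?scale1r. Qed.

Lemma on_quadric_line x : on_quadric f (line x) = (evalf f x == 0).
Proof.
apply/forallP/idP => [/(_ x)|/eqP fx y]; first by rewrite mem_line.
by apply/implyP=> /imsetP[a _ ->]; rewrite evalfZ // fx mulr0.
Qed.

Lemma polar_hyperplane_line x : polar_hyperplane f (line x) = [set y | polar f x y == 0].
Proof.
apply/setP=> y; rewrite !inE.
apply/forallP/idP => [/(_ x)|/eqP fx z]; first by rewrite mem_line.
by apply/implyP=> /imsetP[a _ ->]; rewrite polarZl // fx mulr0.
Qed.

(** The pairs need not be checked to span the polar hyperplane: once they are
    orthogonal to x, the frame they form with x does it by counting. *)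
Lemma hyperbolic_lineP x : evalf f x != 0 ->
  hyperbolic m f (polar_hyperplane f (line x)) <->
  exists e h : 'I_m -> V, hyperbolic_pairs f e h /\ orth_pairs f e h x.
Proof.
move=> fx0; have x0 : x != 0 by apply: contraNneq fx0 => ->; rewrite evalf0.
rewrite polar_hyperplane_line; split.
  move=> /existsP[e /existsP[h /and3P[/forallP diag /forallP off /eqP W]]].
  have {}off i j : i != j -> [/\ polar f (e i) (e j) = 0, polar f (e i) (h j) = 0
      & polar f (h i) (h j) = 0].
    move=> ij; have /forallP/(_ j) := off i.
    by rewrite ij => /and3P[/eqP-> /eqP-> /eqP->].
  have {}diag i : [/\ evalf f (e i) = 0, evalf f (h i) = 0 & polar f (e i) (h i) = 1].
    by have /and3P[/eqP-> /eqP-> /eqP->] := diag i.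
  have perp (a b : {ffun 'I_m -> F}) : polar f x (\sum_i (a i *: e i + b i *: h i)) = 0.
    have : \sum_i (a i *: e i + b i *: h i) \in [set y | polar f x y == 0].
      by rewrite W; apply/imset2P; exists a b.
    by rewrite inE => /eqP.
  exists e, h; split; first split.
  - by move=> i; have [] := diag i.
  - by move=> i; have [] := diag i.
  - move=> i j; have [<-|/off[]//] := eqVneq i j.
    by rewrite polarxx //; have [-> _ _] := diag i; rewrite mulr0.
  - move=> i j; have [<-|/off[]//] := eqVneq i j.
    by rewrite polarxx //; have [_ -> _] := diag i; rewrite mulr0.
  - by move=> i j; have [<-|/off[]//] := eqVneq i j; have [] := diag i.
  move=> i; split; rewrite polarC.
  - rewrite -(perp [ffun j => (j == i)%:R] [ffun => 0]); congr (polar f x _).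
    rewrite (bigD1 i) //= big1 => [|j /negbTE nj]; rewrite !ffunE ?eqxx ?nj;
      by rewrite !(scale0r, scale1r) !addr0.
  - rewrite -(perp [ffun => 0] [ffun j => (j == i)%:R]); congr (polar f x _).
    rewrite (bigD1 i) //= big1 => [|j /negbTE nj]; rewrite !ffunE ?eqxx ?nj;
      by rewrite !(scale0r, scale1r) ?addr0 ?add0r.
move=> [e [h [pairs orthx]]]; have [fe fh ee hh eh] := pairs.
apply/existsP; exists (finfun e); apply/existsP; exists (finfun h); apply/and3P; split.
- by apply/forallP=> i; rewrite !ffunE fe fh eh !eqxx.
- apply/forallP=> i; apply/forallP=> j; apply/implyP=> ij.
  by rewrite !ffunE ee hh eh (negbTE ij) !eqxx.
have combE a b : \sum_i (a i *: finfun e i + b i *: finfun h i) = pair_comb e h a b.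
  by apply: eq_bigr => i _; rewrite !ffunE.
apply/eqP/setP=> y; rewrite inE; apply/eqP/imset2P => [xy|[a b _ _ ->]]; last first.
  by rewrite combE polarC (polar_pair_comb_orth odd_q smooth_f).
have [g _ gK] := frame_bij odd_q smooth_f dim pairs orthx x0.
exists (g y).1.1 (g y).1.2 => //; rewrite combE.
move: xy; rewrite -{1}(gK y) (polar_frame odd_q smooth_f orthx) => /eqP.
rewrite !mulf_eq0 (negbTE two0) (negbTE fx0) !orbF => /eqP c0.
by rewrite -{1}(gK y) /frame c0 scale0r addr0.
Qed.

Section Reflection.

Variable u : V.
Hypothesis fu0 : evalf f u != 0.

Definition reflection y : V := y - (polar f u y / evalf f u) *: u.

Lemma reflectionD y z : reflection (y + z) = reflection y + reflection z.
Proof.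
by rewrite /reflection polarDr // mulrDl scalerDl opprD addrACA.
Qed.

Lemma evalf_reflection y : evalf f (reflection y) = evalf f y.
Proof.
rewrite /reflection -scaleNr evalfD evalfZ // polarZr // [polar f y u]polarC.
by field.
Qed.

Lemma polar_reflection y z : polar f (reflection y) (reflection z) = polar f y z.
Proof. by rewrite /polar -reflectionD !evalf_reflection. Qed.

Lemma reflect_pairs k (e h : 'I_k -> V) z a :
  hyperbolic_pairs f e h -> orth_pairs f e h z ->
  exists e' h' : 'I_k -> V,
    hyperbolic_pairs f e' h' /\ orth_pairs f e' h' (a *: reflection z).
Proof.
move=> [fe fh ee hh eh] orthz.
exists (reflection \o e), (reflection \o h); split.
  by split=> *; rewrite /= ?evalf_reflection ?polar_reflection.
move=> i; have [ez hz] := orthz i.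
by rewrite !polarZr //= !polar_reflection ez hz mulr0.
Qed.

End Reflection.

(** The reflections in x - z and in x + z map z to x and to -x respectively. They
    cannot both be undefined, as f(x - z) + f(x + z) = 4 f(x) is nonzero. *)
Lemma transport_pairs k (e h : 'I_k -> V) x z :
  evalf f z = evalf f x -> evalf f x != 0 ->
  hyperbolic_pairs f e h -> orth_pairs f e h z ->
  exists e' h' : 'I_k -> V, hyperbolic_pairs f e' h' /\ orth_pairs f e' h' x.
Proof.
move=> Ez fx0 pairs orthz.
have fB : evalf f (x - z) = - polar f (x - z) z.
  rewrite -scaleN1r evalfD polarDl // evalfZ // polarZl // polarZr // polarxx // Ez.
  by ring.
have fD : evalf f (x + z) = polar f (x + z) z.
  by rewrite evalfD polarDl // polarxx // Ez; ring.
have [fu0|fu0] := eqVneq (evalf f (x - z)) 0; last first.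
  suff <- : 1 *: reflection (x - z) z = x by apply: reflect_pairs orthz.
  rewrite scale1r /reflection.
  have -> : polar f (x - z) z / evalf f (x - z) = -1.
    by rewrite -[polar f _ z]opprK -fB mulNr divff.
  by rewrite scaleN1r opprK addrC subrK.
have fu1 : evalf f (x + z) != 0.
  have -> : evalf f (x + z) = 2%:R * (2%:R * evalf f x) - evalf f (x - z).
    by rewrite -[- z]scaleN1r !evalfD evalfZ // polarZr // Ez; ring.
  by rewrite fu0 subr0 !mulf_neq0.
suff <- : (-1) *: reflection (x + z) z = x by apply: reflect_pairs orthz.
by rewrite /reflection -fD divff // scale1r scaleN1r opprB addrK.
Qed.

(** The constant d is the value of a vector orthogonal to m hyperbolic pairs. If
    [x] is external, then f(x) can play the role of d in [card_level_set], so the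
    two have the same square class. If d f(x) is a nonzero square c^2, then x has
    the same value as (c / d) z, where z is the vector of value d, and the pairs
    orthogonal to z can be transported to x. *)
Lemma external_internal_qchar : exists d : F,
  [/\ d != 0,
      forall s, #|[set v : V | evalf f v == s]|%:Z =
        #|F|%:Z ^+ n + #|F|%:Z ^+ m * qchar (s * d)
    & forall x, x != 0 ->
      external f (line x) = (qchar (d * evalf f x) == 1) /\
      internal f (line x) = (qchar (d * evalf f x) == -1)].
Proof.
have [|e [h pairs]] := @exists_pairs F n odd_q f smooth_f m; first by rewrite dim.
have [|z z0 perp] := @orthogonal_vector F n odd_q f smooth_f (codom e ++ codom h).
  by rewrite size_cat !size_codom card_ord dim mul2n addnn.
have orthz : orth_pairs f e h z by move=> i; rewrite !perp // mem_cat ?codom_f ?orbT.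
have d0 := evalf_orth_neq0 odd_q smooth_f dim pairs orthz z0.
exists (evalf f z); split=> // [s|x x0].
  by rewrite (card_level_set _ pairs orthz z0).
have n2 : n./2 = m by rewrite dim mul2n doubleK.
rewrite /external /internal on_quadric_line n2.
have [-> | fx0] := eqVneq (evalf f x) 0; first by rewrite mulr0 qchar0.
suff -> : hyperbolic m f (polar_hyperplane f (line x)) =
    (qchar (evalf f z * evalf f x) == 1).
  case: (qcharP odd_q (evalf f z * evalf f x)) => // /eqP.
  by rewrite mulf_eq0 (negbTE d0) (negbTE fx0).
apply/idP/eqP => [/(hyperbolic_lineP fx0)[e' [h' [pairs' orthx]]]|].
  have := card_level_set (evalf f z) pairs' orthx x0.
  rewrite (card_level_set _ pairs orthz z0) => /addrI/mulfI <-.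
    by rewrite -expr2 qchar_sqr.
  by rewrite expf_neq0 //; apply/eqP=> -[] /card0_eq/(_ 0).
case: (qcharP odd_q (evalf f z * evalf f x)) => // c c0 Ec _.
apply/(hyperbolic_lineP fx0).
apply: (@transport_pairs m e h x ((c / evalf f z) *: z)) => //.
  rewrite evalfZ // expr_div_n -Ec; field.
  by rewrite d0.
by move=> i; have [ez hz] := orthz i; rewrite !polarZr // ez hz mulr0.
Qed.

End LevelSets.

(** * Character sums *)

Section CharacterSums.

Variables (F : finFieldType) (n m : nat).
Hypothesis odd_q : odd #|F|.
Let two0 : 2%:R != 0 :> F := odd_card_two_neq0 odd_q.
Local Notation V := 'rV[F]_n.+1.
Local Notation q := (#|F|%:Z).
Hypothesis dim : n = (2 * m)%N.
Hypothesis m_gt0 : (0 < m)%N.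
Implicit Types (f g : {mpoly F[n.+1]}) (x y : V).

Let q_gt0 : 0 < q.
Proof. by rewrite ltz_nat; apply/card_gt0P; exists 0. Qed.

Lemma card_zeros f : smooth_quadric f ->
  #|[set x : V | evalf f x == 0]|%:Z = q ^+ n.
Proof.
move=> smooth_f; have [d [_ card_level _]] := external_internal_qchar odd_q dim smooth_f.
by rewrite card_level mul0r qchar0 mulr0 addr0.
Qed.

(** The main term q^n of the level sets cancels, and what is left is q^m times a
    sum of q squares of chi. *)
Lemma sum_qchar_form d f : d != 0 ->
  (forall s, #|[set x : V | evalf f x == s]|%:Z = q ^+ n + q ^+ m * qchar (s * d)) ->
  `|\sum_x qchar (d * evalf f x)| <= q ^+ n.
Proof.
move=> d0 card_level.
have -> : \sum_x qchar (d * evalf f x) = q ^+ m * \sum_s qchar (d * s) ^+ 2.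
  rewrite (partition_big (evalf f) predT) //=.
  transitivity (\sum_s qchar (d * s) * (q ^+ n + q ^+ m * qchar (s * d))).
    apply: eq_bigr => s _; rewrite -card_level.
    rewrite (eq_bigr (fun=> qchar (d * s))) => [|x /eqP-> //].
    rewrite sumr_const -mulr_natr natz; congr (_ * Posz _).
    by apply: eq_card => x; rewrite !inE.
  under [LHS]eq_bigr => s _ do rewrite mulrDr.
  rewrite big_split /= -mulr_suml sum_qchar_scale // mul0r add0r mulr_sumr.
  by apply: eq_bigr => s _; rewrite mulrCA [s * d]mulrC expr2.
rewrite normrM normrX (ger0_norm (ltW q_gt0)).
apply: (@le_trans _ _ (q ^+ m * q)).
  rewrite ler_pM2l ?exprn_gt0 //; apply: le_trans (ler_norm_sum _ _ _) _.
  apply: (@le_trans _ _ (\sum_(s : F) 1)); last by rewrite sumr_const natz.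
  by apply: ler_sum => s _; rewrite normrX exprn_ile1 ?normr_qchar_le1.
by rewrite -exprSr ler_weXn2l // -?gtz0_ge1 // dim mul2n -addnn -add1n leq_add2r.
Qed.

(** Write chi(f g) as chi(g / f), and sort the vectors by the ratio t; see the
    introduction. A degenerate member of the pencil is nonzero as a polynomial, for
    otherwise the two quadrics would coincide. *)
Lemma sum_qchar_pencil f g : smooth_quadric f -> smooth_quadric g ->
  ~ same_quadric f g ->
  `|\sum_x qchar (evalf f x) * qchar (evalf g x)| <= n.+1%:Z * q ^+ n.
Proof.
move=> smooth_f smooth_g fneqg.
have [homf _] := smooth_f; have [homg _] := smooth_g.
have [bad card_bad good] := card_degenerate_pencil two0 smooth_f homg.
have hompencil t : g - t *: f \is 2.-homog by rewrite rpredB ?rpredZ.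
have evalf_pencil t x : evalf (g - t *: f) x = evalf g x - t * evalf f x.
  by rewrite /evalf mevalB mevalZ.
have ratio x : qchar (evalf f x) * qchar (evalf g x) =
    \sum_t qchar t * (evalf (g - t *: f) x == 0)%:R.
  have [fx0|fx0] := eqVneq (evalf f x) 0.
    (* On the base locus every t contributes; elsewhere on f = 0 none
       does; chi sums to zero. *)
    under eq_bigr => t _ do rewrite evalf_pencil fx0 mulr0 subr0.
    by rewrite -mulr_suml sum_qchar mul0r fx0 qchar0 mul0r.
  rewrite (bigD1 (evalf g x / evalf f x)) //= big1 => [|t nt].
    rewrite evalf_pencil divfK // subrr eqxx mulr1 addr0 -qcharM //.
    rewrite -(qcharM_sqr odd_q (_ / _) fx0); congr qchar.
    by rewrite expr2 mulrA divfK // mulrC.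
  rewrite evalf_pencil subr_eq0; case: eqP => [E|_]; last by rewrite mulr0.
  by rewrite E mulfK // eqxx in nt.
have -> : \sum_x qchar (evalf f x) * qchar (evalf g x) =
    \sum_t qchar t * (#|[set x | evalf (g - t *: f) x == 0]|%:Z - q ^+ n).
  under [RHS]eq_bigr => t _ do rewrite mulrBr.
  rewrite sumrB -mulr_suml sum_qchar mul0r subr0.
  under eq_bigr => x _ do rewrite ratio.
  rewrite exchange_big /=; apply: eq_bigr => t _; rewrite -mulr_sumr; congr (_ * _).
  by rewrite card_set_sum.
apply: le_trans (ler_norm_sum _ _ _) _.
apply: (@le_trans _ _ (\sum_(t in bad) q ^+ n)); last first.
  by rewrite sumr_const -mulr_natl natz ler_pM2r ?exprn_gt0.
rewrite [X in _ <= X]big_mkcond; apply: ler_sum => t _; rewrite normrM.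
case: ifPn => [_|/good nd]; last first.
  by rewrite card_zeros ?subrr ?normr0 ?mulr0.
have [->|t0] := eqVneq t 0; first by rewrite qchar0 normr0 mul0r exprn_ge0 // ltW.
have pencil0 : g - t *: f != 0.
  by apply: contra_not_neq fneqg => /eqP; rewrite subr_eq0 => /eqP ->; exists t.
have := zero_form_card_le two0 (hompencil t) pencil0.
set zeros := #|_| => le2; apply: le_trans (_ : 1 * `|zeros%:Z - q ^+ n| <= _).
  by rewrite ler_wpM2r // normr_qchar_le1.
rewrite mul1r PoszX ler_norml; move: zeros (#|F| ^ n)%N le2 => zeros Q; clear; lia.
Qed.

Definition selected f g (d d' : F) : {set V} :=
  [set x | (qchar (d * evalf f x) == 1) && (qchar (d' * evalf g x) == -1)].

(** The error made by replacing the indicator function by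
    (1 + chi(d f)) (1 - chi(d' g)) / 4 lives on the union of the quadrics, which
    has at most 2 q^n vectors. *)
Lemma card_selected f g d d' : smooth_quadric f -> smooth_quadric g ->
  ~ same_quadric f g -> d != 0 -> d' != 0 ->
  (forall s, #|[set x : V | evalf f x == s]|%:Z = q ^+ n + q ^+ m * qchar (s * d)) ->
  (forall s, #|[set x : V | evalf g x == s]|%:Z = q ^+ n + q ^+ m * qchar (s * d')) ->
  `|4%:Z * #|selected f g d d'|%:Z - q ^+ n.+1| <= (n + 7)%:Z * q ^+ n.
Proof.
move=> smooth_f smooth_g fneqg d0 d'0 cardf cardg.
set eF := fun x => qchar (d * evalf f x); set eG := fun x => qchar (d' * evalf g x).
pose err x : int := 4%:R * (x \in selected f g d d')%:R - 1 - eF x + eG x + eF x * eG x.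
have errE : 4%:Z * #|selected f g d d'|%:Z - q ^+ n.+1 =
    \sum_x err x + \sum_x eF x - \sum_x eG x - \sum_x eF x * eG x.
  rewrite -big_split -!sumrB /=.
  transitivity (\sum_(x : V) (4%:R * (x \in selected f g d d')%:R - 1 : int)); last first.
    by apply: eq_bigr => x _; rewrite /err; ring.
  rewrite sumrB sumr_const card_mx mul1n -mulr_sumr -card_set_sum PoszX.
  suff -> : [set x in selected f g d d'] = selected f g d d' by rewrite !natz.
  by apply/setP=> x; rewrite inE.
have err_le x : `|err x| <= 2%:R * (evalf f x == 0)%:R + 2%:R * (evalf g x == 0)%:R.
  rewrite /err inE /eF /eG.
  have fE : (evalf f x == 0) = (d * evalf f x == 0) by rewrite mulf_eq0 (negbTE d0).
  have gE : (evalf g x == 0) = (d' * evalf g x == 0) by rewrite mulf_eq0 (negbTE d'0).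
  rewrite fE gE; case: (qcharP odd_q (d * _)) => [->|c c0 ->|/negbTE -> _];
  case: (qcharP odd_q (d' * _)) => [->|c' c'0 ->|/negbTE -> _];
    rewrite ?eqxx ?sqrf_eq0 ?(negbTE c0) ?(negbTE c'0) //.
have sum_zeros (h : {mpoly F[n.+1]}) : smooth_quadric h ->
    \sum_x (evalf h x == 0)%:R = q ^+ n.
  by move=> smooth_h; rewrite -(card_zeros smooth_h) card_set_sum.
have le_err : `|\sum_x err x| <= 4%:R * q ^+ n.
  apply: le_trans (ler_norm_sum _ _ _) _.
  apply: le_trans (ler_sum _ (fun x _ => err_le x)) _.
  by rewrite big_split -!mulr_sumr /= !sum_zeros // -mulrDl.
have le_F := sum_qchar_form d0 cardf.
have le_G := sum_qchar_form d'0 cardg.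
have le_FG : `|\sum_x eF x * eG x| <= n.+1%:Z * q ^+ n.
  have -> : \sum_x eF x * eG x =
      qchar (d * d') * \sum_x qchar (evalf f x) * qchar (evalf g x).
    rewrite mulr_sumr; apply: eq_bigr => x _; rewrite /eF /eG !qcharM //; ring.
  rewrite normrM -[X in _ <= X]mul1r ler_pM ?normr_qchar_le1 //.
  exact: sum_qchar_pencil.
have Q0 : 0 <= q ^+ n by rewrite exprn_ge0 // ltW.
rewrite errE; move: le_err le_F le_G le_FG.
have -> : (n + 7)%:Z * q ^+ n = n.+1%:Z * q ^+ n + 6%:Z * q ^+ n.
  by rewrite -mulrDl -PoszD addSnnS.
rewrite -/eF -/eG !ler_norml => /andP[? ?] /andP[? ?] /andP[? ?] /andP[? ?].
by apply/andP; split; lra.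
Qed.

Lemma card_line_fibre x0 : x0 != 0 ->
  #|[set x : V | (x != 0) && (line x == line x0)]| = #|F|.-1.
Proof.
move=> x00; rewrite -(cardC1 (0 : F)).
rewrite -(card_imset _ (_ : injective (fun a : F => a *: x0))).
  apply: eq_card => x; rewrite !inE; apply/andP/imsetP => [[x_neq0 /eqP Ex]|[a a0 ->]].
    have /imsetP[a _ Ea] : x \in line x0 by rewrite -Ex mem_line.
    by exists a => //; rewrite inE; apply: contraNneq x_neq0 => a0; rewrite Ea a0 scale0r.
  rewrite inE in a0; split; first by rewrite scaler_eq0 negb_or a0.
  apply/eqP/setP=> y; apply/imsetP/imsetP => -[b _ ->].
    by exists (b * a); rewrite ?scalerA.
  by exists (b / a); rewrite // scalerA divfK.
move=> a b /eqP; rewrite -subr_eq0 -scalerBl scaler_eq0 (negbTE x00) orbF.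
by rewrite subr_eq0 => /eqP.
Qed.

(** Each point consists of zero and q - 1 nonzero vectors. *)
Lemma card_projective (p : pred {set V}) :
  (#|[set x : V | (x != 0%R) && p (line x)]| =
   #|[set P in proj_space F n | p P]| * #|F|.-1)%N.
Proof.
rewrite -sum1_card (partition_big (@line F n) (mem [set P in proj_space F n | p P])) /=.
  rewrite -sum_nat_const; apply: eq_bigr => P; rewrite inE.
  move=> /andP[/imsetP[x0 x00 ->] px0].
  rewrite inE in x00; rewrite sum1dep_card -(card_line_fibre x00); apply: eq_card => x.
  by rewrite !inE -andbA; congr (_ && _); case: eqP => [->|_]; rewrite ?andbT ?andbF.
move=> x; rewrite !inE => /andP[x0 ->]; rewrite andbT.
by apply/imsetP; exists x; rewrite ?inE.
Qed.

(** The zero vector has chi = 0, so it is not selected and the points correspond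
    exactly to classes of selected vectors. *)
Lemma external_internal_count f g : smooth_quadric f -> smooth_quadric g ->
  ~ same_quadric f g ->
  `|4%:Z * (num_external_internal f g * #|F|.-1)%N%:Z - q ^+ n.+1| <= (n + 7)%:Z * q ^+ n.
Proof.
move=> smooth_f smooth_g fneqg.
have [d [d0 cardf extf]] := external_internal_qchar odd_q dim smooth_f.
have [d' [d'0 cardg intg]] := external_internal_qchar odd_q dim smooth_g.
rewrite -card_projective.
suff -> : [set x : V | (x != 0) && (external f (line x) && internal g (line x))] =
    selected f g d d'.
  exact: card_selected.
apply/setP=> x; rewrite !inE; have [->|x0] := eqVneq x 0.
  by rewrite evalf0 ?mulr0 ?qchar0 //; case: smooth_f.
by have [-> _] := extf _ x0; have [_ ->] := intg _ x0.
Qed.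

End CharacterSums.

(** * The bound *)

Lemma computes_iter_succ j k :
  computes (iter j (fun p => MComp MSucc (fun=> p)) (MProj (ord0 : 'I_1)))
    [tuple k] (k + j).
Proof.
elim: j => [|j IHj] /=; first by rewrite addn0.
exists [tuple (k + j)%N]; split; first by move=> i; rewrite (tnth_nth 0%N) [i]ord1.
by rewrite theadE addnS.
Qed.

Theorem corollary9 :
  exists c : nat -> nat, effectively_computable c /\
  forall n : nat, (2 <= n)%N -> ~~ odd n ->
  forall F : finFieldType, odd #|F| ->
  forall f g : {mpoly F[n.+1]},
  smooth_quadric f -> smooth_quadric g -> ~ same_quadric f g ->
  forall (R : rcfType),
  let q : R := #|F|%:R in
  let N : R := (num_external_internal f g)%:R in
  `|N - q ^+ n / 4%:R| <=
    3%:R / 2%:R * Num.sqrt q ^+ (2 * n - 1) + (c n)%:R * q ^+ (n - 1).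
Proof.
exists (fun n => (n + 8)%N); split.
  exists (iter 8 (fun p => MComp MSucc (fun=> p)) (MProj (ord0 : 'I_1))) => k.
  exact: computes_iter_succ.
move=> n n2 even_n F odd_q f g smooth_f smooth_g fneqg R /=; set q : R := #|F|%:R.
set N : R := (num_external_internal f g)%:R.
have dim : n = (2 * n./2)%N by rewrite mul2n even_halfK.
have m_gt0 : (0 < n./2)%N by rewrite half_gt0.
have bound := external_internal_count odd_q dim m_gt0 smooth_f smooth_g fneqg.
have q_gt1 : (1 < #|F|)%N by have := card_finRing_gt1 F.
have Eqn : q ^+ n = q * q ^+ (n - 1) by rewrite -exprS; congr (_ ^+ _); lia.
rewrite -(ler_int R) in bound.
rewrite intr_norm rmorphB /= !rmorphM /= !rmorphXn /= in bound.
rewrite -!pmulrn -/q -/N -subn1 natrB -/q in bound; last exact: ltnW.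
rewrite exprS Eqn in bound; rewrite Eqn; set y := q ^+ (n - 1) in bound *.
have y_ge0 : 0 <= y by rewrite exprn_ge0 // ler0n.
have q_ge2 : 2%:R <= q by rewrite ler_nat.
apply: le_trans (_ : (n + 8)%:R * y <= _); last first.
  by rewrite lerDr mulr_ge0 ?exprn_ge0 ?sqrtr_ge0 // divr_ge0 ?ler0n.
(* Multiply by q - 1, and use q <= 2 (q - 1) on the error term. *)
move: bound; rewrite !natrD ler_norml => /andP[lo up].
have q1 : 0 < q - 1 by lra.
have two_y : 0 <= (q - 2%:R) * y by rewrite mulr_ge0 // subr_ge0.
have ny : 0 <= n%:R * ((q - 2%:R) * y) by rewrite mulr_ge0 ?ler0n.
rewrite -(ler_pM2r q1) -[X in _ * X]gtr0_norm // -normrM ler_norml.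
by apply/andP; split; lra.
Qed.
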